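(* Let $M$ be a $\lambda$-term. Then for every finite or infinite leftmost-outermost $\beta$-reduction rewrite sequence $\sigma : M = M_0 \to_{lo\beta} M_1 \to_{lo\beta} \cdots \to_{lo\beta} M_k \ (\to_{lo\beta} M_{k+1} \to_{lo\beta} \cdots)$ starting from $M$, of length $l\in\mathbb{N}\cup\{\infty\}$, the following hold: (i) $\mathrm{depth}(M_{n+1}) \le \mathrm{depth}(M_n) + \mathrm{depth}(M)$ for all $n\in\mathbb{N}$ with $n+1\le l$, i.e. the depth increase in each step of $\sigma$ is uniformly bounded by $\mathrm{depth}(M)$; (ii) $\mathrm{depth}(M_n) \le \mathrm{depth}(M) + n\cdot\mathrm{depth}(M) = (n+1)\cdot\mathrm{depth}(M)$ for all $n\in\mathbb{N}$ with $n\le l$; hence $\mathrm{depth}(M_n)-\mathrm{depth}(M)\in O(n)$.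
   Context: $\lambda$-terms are taken modulo $\alpha$-conversion. $\to_{lo\beta}$ denotes leftmost-outermost $\beta$-reduction, i.e. contraction of the leftmost-outermost $\beta$-redex. The depth $\mathrm{depth}(M)$ of a $\lambda$-term is the length of the longest path from the root to a leaf in its syntax tree (a variable has depth $0$, $\mathrm{depth}(\lambda x.N)=1+\mathrm{depth}(N)$, $\mathrm{depth}(N\,P)=1+\max\{\mathrm{depth}(N),\mathrm{depth}(P)\}$). *)

(* Defs.v *)
From Stdlib Require Import List Arith ZArith.
Import ListNotations.

(* De Bruijn terms: lambda-terms modulo alpha-conversion. An index that points
   beyond all enclosing abstractions is a free variable. *)
Inductive term : Type :=
| Var (i : nat)
| Lam (M : term)
| App (M N : term).

Fixpoint depth (M : term) : nat :=
  match M with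
  | Var _ => 0
  | Lam N => 1 + depth N
  | App N P => 1 + Nat.max (depth N) (depth P)
  end.

(* Renumbering of the variables >= k of M when one abstraction is crossed. *)
Fixpoint lift (k : nat) (M : term) : term :=
  match M with
  | Var i => if i <? k then Var i else Var (S i)
  | Lam N => Lam (lift (S k) N)
  | App N P => App (lift k N) (lift k P)
  end.

(* [subst k Q M] replaces variable k of M by Q and decrements the variables
   > k, since the abstraction binding k is removed by the contraction. *)
Fixpoint subst (k : nat) (Q M : term) : term :=
  match M with
  | Var i => if i =? k then Q else if k <? i then Var (pred i) else Var i
  | Lam N => Lam (subst (S k) (lift 0 Q) N)
  | App N P => App (subst k Q N) (subst k Q P)
  end.

Inductive direction : Type := Body | Fun | Arg.

(* Directions from the root of the syntax tree; the empty list is the root. *)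
Definition position : Type := list direction.

(* [contract p M N]: M has a beta-redex at position p, whose contraction
   yields N. *)
Inductive contract : position -> term -> term -> Prop :=
| contract_root P Q :
    contract [] (App (Lam P) Q) (subst 0 Q P)
| contract_body p M N :
    contract p M N -> contract (Body :: p) (Lam M) (Lam N)
| contract_fun p M N P :
    contract p M N -> contract (Fun :: p) (App M P) (App N P)
| contract_arg p M N P :
    contract p M N -> contract (Arg :: p) (App P M) (App P N).

Definition redex (M : term) (p : position) : Prop :=
  exists N, contract p M N.

Definition prefix (p q : position) : Prop := exists r, q = p ++ r.

Definition left_of (p q : position) : Prop :=
  exists r p' q', p = r ++ Fun :: p' /\ q = r ++ Arg :: q'.

Definition outermost_redex (M : term) (p : position) : Prop :=
  redex M p /\ forall q, redex M q -> prefix q p -> q = p.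

Definition lo_redex (M : term) (p : position) : Prop :=
  outermost_redex M p /\
  forall q, outermost_redex M q -> q <> p -> left_of p q.

Definition lo_step (M N : term) : Prop :=
  exists p, lo_redex M p /\ contract p M N.

(* The set of natural numbers extended with infinity. *)
Inductive natinf : Type :=
| Fin (n : nat)
| Inf.

Definition le_natinf (n : nat) (l : natinf) : Prop :=
  match l with
  | Fin m => n <= m
  | Inf => True
  end.

(* [s] restricted to the indices n <= l is a rewrite sequence with l steps;
   for finite l the values of s beyond l are irrelevant. *)
Definition lo_sequence (M : term) (l : natinf) (s : nat -> term) : Prop :=
  s 0 = M /\ forall n, le_natinf (n + 1) l -> lo_step (s n) (s (n + 1)).

(* f(n) in O(n) for an integer-valued f defined on the indices n <= l. No
   threshold on n is allowed: it would make the notion vacuous for finite l. *)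
Definition linear_O (l : natinf) (f : nat -> Z) : Prop :=
  exists C : nat, forall n, le_natinf n l ->
    (Z.abs (f n) <= Z.of_nat C * Z.of_nat n)%Z.

(* Main.v *)
(** Call a term [d]-bounded if in each subterm [Lam P] the variable bound by
    that [Lam] occurs in [P] at depth at most [d]. Contracting a [d]-bounded
    redex increases the depth by at most [d], and substitution preserves
    [d]-boundedness, because no occurrence of a locally bound variable is
    moved. Contraction below a [Lam] destroys it, but a leftmost-outermost step
    happens below a [Lam] only if that [Lam] will never be applied, that is, if
    it lies on a path that passes through abstractions and through applications
    headed by a variable. So the invariant of the sequence is that the term is
    [d]-bounded below such a stable part of the syntax tree, and
    [d = depth M] works for the initial term. *)
Require Import Defs.
From Stdlib Require Import Arith ZArith List Lia.
Import ListNotations.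

(** * Occurrences of variables and depth *)

(** [n] is the depth of a single occurrence. As a relation, this makes bounds on all occurrences
    vacuous for a variable that does not occur. *)
Inductive occ : nat -> term -> nat -> Prop :=
| occ_var k : occ k (Var k) 0
| occ_lam k N n : occ (S k) N n -> occ k (Lam N) (S n)
| occ_fun k N P n : occ k N n -> occ k (App N P) (S n)
| occ_arg k N P n : occ k P n -> occ k (App N P) (S n).

Lemma occ_le_depth k M n : occ k M n -> n <= depth M.
Proof. induction 1; simpl; lia. Qed.

Lemma occ_lift Q : forall k j n, occ j (lift k Q) n ->
  (j < k /\ occ j Q n) \/ (k < j /\ occ (pred j) Q n).
Proof.
  induction Q as [i|Q IH|Q1 IH1 Q2 IH2]; simpl; intros k j n H.
  - destruct (Nat.ltb_spec i k); inversion H; subst; [left|right];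
      split; try lia; constructor.
  - inversion H as [|? ? n' H'| |]; subst.
    destruct (IH _ _ _ H') as [[? ?]|[? ?]]; [left|right];
      split; try lia; constructor; auto.
    destruct j; [lia|assumption].
  - inversion H as [| |? ? ? n' H'|? ? ? n' H']; subst;
      [destruct (IH1 _ _ _ H') as [[? ?]|[? ?]]
      |destruct (IH2 _ _ _ H') as [[? ?]|[? ?]]];
      solve [left; split; [lia|constructor; assumption]
            |right; split; [lia|constructor; assumption]
            |left; split; [lia|apply occ_arg; assumption]
            |right; split; [lia|apply occ_arg; assumption]].
Qed.

(** An occurrence in the result either stems from [P], at unchanged depth, or lies in a copy of [Q],
    which the hypothesis on [Q] excludes. *)
Lemma occ_subst P : forall k j Q n, j < k -> (forall m, ~ occ j Q m) ->
  occ j (subst k Q P) n -> occ j P n.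
Proof.
  induction P as [i|P IH|P1 IH1 P2 IH2]; simpl; intros k j Q n Hjk HQ H.
  - destruct (Nat.eqb_spec i k); [now destruct (HQ n)|].
    destruct (Nat.ltb_spec k i); [inversion H; lia|assumption].
  - inversion H as [|? ? n' H'| |]; subst. constructor.
    apply (IH (S k) (S j) (lift 0 Q)); [lia| |assumption].
    intros m Hm. destruct (occ_lift _ _ _ _ Hm) as [[? ?]|[_ Ho]]; [lia|].
    exact (HQ _ Ho).
  - inversion H; subst; [apply occ_fun|apply occ_arg]; eauto.
Qed.

Lemma depth_lift M : forall k, depth (lift k M) = depth M.
Proof.
  induction M as [i|M IH|M1 IH1 M2 IH2]; simpl; intros k.
  - now destruct (i <? k).
  - now rewrite IH.
  - now rewrite IH1, IH2.
Qed.

(** A path in the result stays in [P] or enters a copy of [Q] at an occurrence of [k]. The free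
    bound [m] drops by one under each constructor, as do the occurrence depths. *)
Lemma depth_subst_le P : forall k Q m, depth P <= m ->
  (forall n, occ k P n -> n + depth Q <= m) -> depth (subst k Q P) <= m.
Proof.
  induction P as [i|P IH|P1 IH1 P2 IH2]; simpl; intros k Q m Hm Hocc.
  - destruct (Nat.eqb_spec i k) as [->|].
    + exact (Hocc 0 (occ_var k)).
    + destruct (k <? i); simpl; lia.
  - destruct m as [|m]; [lia|]. apply le_n_S, IH; [lia|].
    intros n Hn. rewrite depth_lift. specialize (Hocc _ (occ_lam _ _ _ Hn)). lia.
  - destruct m as [|m]; [lia|]. apply le_n_S, Nat.max_lub.
    + apply IH1; [lia|].
      intros n Hn. specialize (Hocc _ (occ_fun _ _ P2 _ Hn)). lia.
    + apply IH2; [lia|].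
      intros n Hn. specialize (Hocc _ (occ_arg _ P1 _ _ Hn)). lia.
Qed.

Fixpoint bounded (d : nat) (M : term) : Prop :=
  match M with
  | Var _ => True
  | Lam P => (forall n, occ 0 P n -> n <= d) /\ bounded d P
  | App N P => bounded d N /\ bounded d P
  end.

Lemma bounded_depth M : forall d, depth M <= d -> bounded d M.
Proof.
  induction M as [i|M IH|M1 IH1 M2 IH2]; simpl; intros d Hd.
  - exact I.
  - split; [|apply IH; lia].
    intros n Hn. apply occ_le_depth in Hn. lia.
  - split; [apply IH1|apply IH2]; lia.
Qed.

Lemma bounded_lift d M : forall k, bounded d M -> bounded d (lift k M).
Proof.
  induction M as [i|M IH|M1 IH1 M2 IH2]; simpl; intros k H.
  - now destruct (i <? k).
  - destruct H as [Hocc H]. split; [|auto].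
    intros n Hn. destruct (occ_lift _ _ _ _ Hn) as [[_ Ho]|[? _]]; [auto|lia].
  - destruct H; auto.
Qed.

Lemma bounded_subst d P : forall k Q,
  bounded d P -> bounded d Q -> bounded d (subst k Q P).
Proof.
  induction P as [i|P IH|P1 IH1 P2 IH2]; simpl; intros k Q HP HQ.
  - destruct (i =? k); [assumption|]. now destruct (k <? i).
  - destruct HP as [Hocc HP]. split.
    + intros n Hn. apply Hocc. revert Hn. apply occ_subst; [lia|].
      (* The variable bound here is not captured: an occurrence of [0] in [lift 0 Q] would require
         [0 < 0]. *)
      intros m Hm. destruct (occ_lift _ _ _ _ Hm) as [[? ?]|[? ?]]; lia.
    + apply IH; [assumption|now apply bounded_lift].
  - destruct HP; auto.
Qed.

(** * Leftmost-outermost steps *)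

Definition is_lam (M : term) : Prop := exists P, M = Lam P.

(** The neutral terms [x N1 ... Nk], with arbitrary arguments; applying one creates no redex. *)
Fixpoint var_headed (M : term) : Prop :=
  match M with
  | Var _ => True
  | Lam _ => False
  | App N _ => var_headed N
  end.

(** An over-approximation of [lo_step]: in [lo_arg], the arguments of the neutral term [P] may still
    contain redexes further left. *)
Inductive lo : term -> term -> Prop :=
| lo_root P Q : lo (App (Lam P) Q) (subst 0 Q P)
| lo_lam M N : lo M N -> lo (Lam M) (Lam N)
| lo_fun M N P : ~ is_lam M -> lo M N -> lo (App M P) (App N P)
| lo_arg M N P : var_headed P -> lo M N -> lo (App P M) (App P N).

Lemma is_lam_dec M : is_lam M \/ ~ is_lam M.
Proof.
  destruct M; [right|left; now eexists|right]; intros [P HP]; discriminate.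
Qed.

Lemma prefix_cons a p q : prefix (a :: p) (a :: q) <-> prefix p q.
Proof.
  split; intros [r Hr]; exists r; simpl in *; congruence.
Qed.

Lemma prefix_cons_r q a p : prefix q (a :: p) ->
  q = [] \/ exists q', q = a :: q' /\ prefix q' p.
Proof.
  intros [r Hr]. destruct q as [|b q]; [now left|right].
  simpl in Hr. injection Hr as <- ->. exists q. split; [reflexivity|now exists r].
Qed.

Lemma left_of_cons a p q : left_of (a :: p) (a :: q) -> left_of p q.
Proof.
  intros ([|b r] & p' & q' & Hp & Hq); simpl in Hp, Hq; [congruence|].
  injection Hp as _ ->. injection Hq as _ ->. now exists r, p', q'.
Qed.

Lemma not_left_of_arg_fun p q : ~ left_of (Arg :: p) (Fun :: q).
Proof.
  intros ([|b r] & p' & q' & Hp & Hq); simpl in Hp, Hq; congruence.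
Qed.

Lemma redex_nil M : redex M [] -> exists P Q, M = App (Lam P) Q.
Proof. intros [N HN]. inversion HN; eauto. Qed.

Lemma redex_body M p : redex (Lam M) (Body :: p) <-> redex M p.
Proof.
  split; intros [N HN]; [inversion HN; subst; eexists; eassumption|].
  exists (Lam N). now constructor.
Qed.

Lemma redex_fun M P p : redex (App M P) (Fun :: p) <-> redex M p.
Proof.
  split; intros [N HN]; [inversion HN; subst; eexists; eassumption|].
  exists (App N P). now constructor.
Qed.

Lemma redex_arg M P p : redex (App P M) (Arg :: p) <-> redex M p.
Proof.
  split; intros [N HN]; [inversion HN; subst; eexists; eassumption|].
  exists (App P N). now constructor.
Qed.

Lemma outermost_body M p :
  outermost_redex (Lam M) (Body :: p) <-> outermost_redex M p.
Proof.
  unfold outermost_redex. rewrite redex_body. split; intros [Hp Hq]; split; auto.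
  - intros q Hr Hpre. apply redex_body in Hr.
    assert (Body :: q = Body :: p) as E by (apply Hq; [|apply prefix_cons]; auto).
    now injection E.
  - intros q Hr Hpre. apply prefix_cons_r in Hpre as [->|(q' & -> & Hpre)].
    + apply redex_nil in Hr as (? & ? & ?). discriminate.
    + f_equal. apply Hq; [now rewrite redex_body in Hr|assumption].
Qed.

(** The only new position above the redex is the root, which is a redex exactly when [M] is an
    abstraction. *)
Lemma outermost_fun M P p :
  outermost_redex (App M P) (Fun :: p) <-> ~ is_lam M /\ outermost_redex M p.
Proof.
  unfold outermost_redex. rewrite redex_fun. split.
  - intros [Hp Hq]. split; [|split; auto].
    + intros [B ->].
      assert ([] = Fun :: p) as E; [|discriminate E].
      apply Hq; [exists (subst 0 P B); constructor|now exists (Fun :: p)].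
    + intros q Hr Hpre. apply (redex_fun M P) in Hr.
      assert (Fun :: q = Fun :: p) as E by (apply Hq; [|apply prefix_cons]; auto).
      now injection E.
  - intros (Hl & Hp & Hq). split; auto.
    intros q Hr Hpre. apply prefix_cons_r in Hpre as [->|(q' & -> & Hpre)].
    + apply redex_nil in Hr as (B & ? & E). injection E as -> ->.
      destruct Hl. now exists B.
    + f_equal. apply Hq; [now rewrite redex_fun in Hr|assumption].
Qed.

Lemma outermost_arg M P p :
  outermost_redex (App P M) (Arg :: p) <-> ~ is_lam P /\ outermost_redex M p.
Proof.
  unfold outermost_redex. rewrite redex_arg. split.
  - intros [Hp Hq]. split; [|split; auto].
    + intros [B ->].
      assert ([] = Arg :: p) as E; [|discriminate E].
      apply Hq; [exists (subst 0 M B); constructor|now exists (Arg :: p)].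
    + intros q Hr Hpre. apply (redex_arg M P) in Hr.
      assert (Arg :: q = Arg :: p) as E by (apply Hq; [|apply prefix_cons]; auto).
      now injection E.
  - intros (Hl & Hp & Hq). split; auto.
    intros q Hr Hpre. apply prefix_cons_r in Hpre as [->|(q' & -> & Hpre)].
    + apply redex_nil in Hr as (B & ? & E). injection E as -> ->.
      destruct Hl. now exists B.
    + f_equal. apply Hq; [now rewrite redex_arg in Hr|assumption].
Qed.

(** Descending along function parts, one reaches either a variable or a first applied abstraction,
    with no redex above it. *)
Lemma var_headed_or_outermost M :
  ~ is_lam M -> var_headed M \/ exists p, outermost_redex M p.
Proof.
  induction M as [i|M IH|M IH P _]; intros Hl.
  - now left.
  - destruct Hl. now exists M.
  - destruct (is_lam_dec M) as [[B ->]|HM].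
    + right. exists []. split; [exists (subst 0 P B); constructor|].
      intros q _ [r Hr]. now destruct q.
    + destruct (IH HM) as [Hv|[p Hp]]; [now left|right].
      exists (Fun :: p). now apply outermost_fun.
Qed.

Lemma lo_of_contract p M N : contract p M N -> lo_redex M p -> lo M N.
Proof.
  intros Hc. induction Hc as [P Q|p M N Hc IH|p M N P Hc IH|p M N P Hc IH];
    intros [Hout Hleft].
  - apply lo_root.
  - apply lo_lam, IH. split; [now apply outermost_body|].
    intros q Hq Hne. apply (left_of_cons Body), Hleft; [|congruence].
    now apply outermost_body.
  - apply outermost_fun in Hout as [Hl Hout].
    apply lo_fun; [assumption|]. apply IH. split; [assumption|].
    intros q Hq Hne. apply (left_of_cons Fun), Hleft; [|congruence].
    now apply outermost_fun.
  - apply outermost_arg in Hout as [Hl Hout].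
    apply lo_arg.
    + destruct (var_headed_or_outermost P Hl) as [Hv|[q Hq]]; [assumption|].
      (* An outermost redex of [P] at [q] is one of the application at [Fun :: q], to the left of
         the contracted one. *)
      exfalso. apply (not_left_of_arg_fun p q), Hleft; [|discriminate].
      now apply outermost_fun.
    + apply IH. split; [assumption|].
      intros q Hq Hne. apply (left_of_cons Arg), Hleft; [|congruence].
      now apply outermost_arg.
Qed.

Lemma lo_of_lo_step M N : lo_step M N -> lo M N.
Proof. intros (p & Hp & Hc). exact (lo_of_contract p M N Hc Hp). Qed.

(** * The invariant *)

(** [sb_lam] and [sb_app] build the stable part; its abstractions carry no bound on their
    variables. *)
Inductive stably_bounded (d : nat) : term -> Prop :=
| sb_bounded M : bounded d M -> stably_bounded d M
| sb_lam M : stably_bounded d M -> stably_bounded d (Lam M)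
| sb_app N P : var_headed N -> stably_bounded d N -> stably_bounded d P ->
    stably_bounded d (App N P).

Lemma stably_bounded_lam d M : stably_bounded d (Lam M) -> stably_bounded d M.
Proof.
  intros H. inversion H as [? Hb| |]; subst; [|assumption].
  apply sb_bounded, Hb.
Qed.

Lemma stably_bounded_app d M N : stably_bounded d (App M N) ->
  stably_bounded d M /\ stably_bounded d N /\
  (var_headed M \/ bounded d (App M N)).
Proof.
  intros H. inversion H as [? Hb| |]; subst; [|auto].
  split; [apply sb_bounded, Hb|]. split; [apply sb_bounded, Hb|now right].
Qed.

Lemma lo_var_headed M N : lo M N -> var_headed M -> var_headed N.
Proof. induction 1; simpl; tauto. Qed.

(** Without a variable at the head, the step contracts the head redex, hence works below no
    abstraction, and only substitution has to preserve the bound. *)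
Lemma lo_bounded d M N : lo M N -> ~ is_lam M -> bounded d M ->
  var_headed M \/ bounded d N.
Proof.
  induction 1 as [P Q|M N HMN IH|M N P Hl HMN IH|M N P Hv HMN IH];
    simpl; intros HM Hb.
  - right. destruct Hb as [[_ HP] HQ]. now apply bounded_subst.
  - destruct HM. now exists M.
  - destruct Hb. destruct IH; auto.
  - now left.
Qed.

Lemma lo_stably_bounded d M N :
  lo M N -> stably_bounded d M -> stably_bounded d N.
Proof.
  induction 1 as [P Q|M N HMN IH|M N P Hl HMN IH|M N P Hv HMN IH]; intros H.
  (* The function part is a [Lam], hence not [var_headed], so the redex lies in the bounded
     region. *)
  - apply stably_bounded_app in H as (_ & _ & [[]|[[_ HP] HQ]]).
    now apply sb_bounded, bounded_subst.
  - apply sb_lam, IH. now apply stably_bounded_lam.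
  - apply stably_bounded_app in H as (HM & HP & Hor).
    assert (var_headed M \/ bounded d N /\ bounded d P) as [Hv|Hb].
    { destruct Hor as [|[HbM HbP]]; [now left|].
      destruct (lo_bounded d M N HMN Hl HbM); auto. }
    + apply sb_app; auto. exact (lo_var_headed _ _ HMN Hv).
    + now apply sb_bounded.
  - apply stably_bounded_app in H as (HP & HM & _). apply sb_app; auto.
Qed.

Lemma lo_depth_le d M N :
  lo M N -> stably_bounded d M -> depth N <= depth M + d.
Proof.
  induction 1 as [P Q|M N HMN IH|M N P Hl HMN IH|M N P Hv HMN IH]; intros H.
  - apply stably_bounded_app in H as (_ & _ & [[]|[[Hocc _] _]]).
    (* Here [m] is the depth of the redex plus [d]: [Q] is no deeper than the redex and is inserted
       at depth at most [d]. *)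
    apply depth_subst_le; cbn [depth]; [lia|].
    intros n Hn. apply Hocc in Hn. lia.
  - apply stably_bounded_lam in H. specialize (IH H). simpl. lia.
  - apply stably_bounded_app in H as (HM & _). specialize (IH HM). simpl. lia.
  - apply stably_bounded_app in H as (_ & HM & _). specialize (IH HM). simpl. lia.
Qed.

Lemma le_natinf_pred n l : le_natinf (n + 1) l -> le_natinf n l.
Proof. destruct l; simpl; lia. Qed.

Theorem theorem3p11 (M : term) (l : natinf) (s : nat -> term)
    (Hs : lo_sequence M l s) :
  (forall n, le_natinf (n + 1) l ->
     depth (s (n + 1)) <= depth (s n) + depth M) /\
  (forall n, le_natinf n l ->
     depth (s n) <= depth M + n * depth M /\
     depth M + n * depth M = (n + 1) * depth M) /\
  linear_O l (fun n => (Z.of_nat (depth (s n)) - Z.of_nat (depth M))%Z).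
Proof.
  destruct Hs as [H0 Hstep].
  assert (forall n, le_natinf n l -> stably_bounded (depth M) (s n)) as Hinv.
  { induction n as [|n IH]; intros Hn.
    - rewrite H0. apply sb_bounded, bounded_depth. lia.
    - replace (S n) with (n + 1) in * by lia.
      eapply lo_stably_bounded; [apply lo_of_lo_step, Hstep, Hn|].
      now apply IH, le_natinf_pred. }
  assert (forall n, le_natinf (n + 1) l ->
            depth (s (n + 1)) <= depth (s n) + depth M) as Hi.
  { intros n Hn. apply lo_depth_le; [apply lo_of_lo_step, Hstep, Hn|].
    now apply Hinv, le_natinf_pred. }
  assert (forall n, le_natinf n l -> depth (s n) <= depth M + n * depth M) as Hii.
  { induction n as [|n IH]; intros Hn.
    - rewrite H0. lia.
    - replace (S n) with (n + 1) in * by lia. specialize (Hi n Hn).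
      apply le_natinf_pred, IH in Hn. lia. }
  split; [exact Hi|]. split.
  - intros n Hn. split; [now apply Hii|lia].
  (* The absolute value also covers decreases: these are at most [depth M], hence at most
     [n * depth M] once [n >= 1]; at [n = 0] the difference is zero. *)
  - exists (depth M). intros n Hn. destruct n as [|n].
    + rewrite H0. lia.
    + specialize (Hii _ Hn). nia.
Qed.
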